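(* Let $G$ be a Lie group acting on $Q$, such that $gQ=Q$ for all $g\in G$. Let $\varphi(t;\{q^\nu\}_{\nu=0}^r)$ be an interpolatory function. If $\varphi$ is $G$-equivariant, i.e. $\varphi(t;\{gq^\nu\}_{\nu=0}^r)=g\,\varphi(t;\{q^\nu\}_{\nu=0}^r)$ for all $g\in G$, and the generalized Lagrangian $R:TQ\oplus T^*Q\to\mathbb{R}$, $$R(q,\dot q,p)=p\dot q-H(q,p),$$ is $G$-invariant, then the generalized discrete Lagrangian $R_d:Q\times T^*Q\to\mathbb{R}$ given by $$R_d(q_0,q_1,p_1)=p_1q_1-H_d^+(q_0,p_1),$$ where $$H_d^+(q_0,p_1)=\operatorname*{ext}_{\substack{q^\nu\in Q,\ p^i\in Q^*\\ q^0=q_0}}\left[p_1\cdot\varphi\left(h;\{q^\nu\}_{\nu=0}^r\right)-\sum_{i=1}^sb_iR\left(T\varphi\left(c_ih;\{q^\nu\}_{\nu=0}^r\right),p^i\right)\right],$$ is $G$-invariant.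
   Context: One works in canonical coordinates on $T^*Q$, with $Q$ an $n$-dimensional configuration manifold; $H:T^*Q\to\mathbb{R}$ is a Hamiltonian and $h>0$ a time step. The interpolatory function $\varphi:Q^{r+1}\to C^2([0,h],Q)$ is parameterized by $r+1$ internal points $q^\nu\in Q$, $\nu=0,\dots,r$, defined at times $0=d_0h<d_1h<\dots<d_rh\le h$, i.e. $\varphi(d_\eta h;\{q^\nu\}_{\nu=0}^r)=q^\eta$. $T\varphi(t;\{q^\nu\})\in TQ$ denotes the point of the curve at time $t$ together with its time derivative. $b_i$ and $c_i$, $i=1,\dots,s$, are the weights and points of a numerical quadrature formula on $[0,1]$, and $p^i$ denotes the momentum at time $c_ih$. $\operatorname{ext}$ denotes the extremal (stationary) value over the indicated variables, assumed to be well defined. $G$ acts on $Q$ by $q\mapsto gq$, on $TQ$ by the tangent lift $TL_g$, and on $T^*Q$ by the cotangent lifted action, written $(q,p)\mapsto(gq,gp)$, where $gp$ has components $p_j\,\partial q^j/\partial(gq)^i$. $G$-invariance of $R$ means invariance under the simultaneous lifted actions on $(q,\dot q)$ and $(q,p)$; $G$-invariance of $R_d$ means $R_d(gq_0,gq_1,gp_1)=R_d(q_0,q_1,p_1)$ for all $g\in G$, where $gp_1$ is the momentum component of the lifted action on $(q_1,p_1)$.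
   Formalization: Q is an open subset of R^n (global coordinates), and each g is additionally assumed to act on Q by an affine map in these coordinates; for non-affine actions the pairings p_1q_1 and p_1·φ(h) do not transform compatibly and the claim fails. *)

(* Defs.v *)
From HB Require Import structures.
From mathcomp Require Import all_boot all_order all_algebra.
From mathcomp Require Import all_classical all_reals all_analysis.

Set Implicit Arguments.
Unset Strict Implicit.
Unset Printing Implicit Defensive.

Import Order.TTheory GRing.Theory Num.Theory.
Import numFieldNormedType.Exports.

Local Open Scope classical_set_scope.
Local Open Scope ring_scope.

(* The pairing p . v of a covector with a vector, both stored as rows. *)
Definition pairing (R : realType) (n : nat) (p v : 'rV[R]_n) : R :=
  \sum_i p 0 i * v 0 i.

(** Smooth maps and Lie groups *)

(* C^k on an open set U. For finite-dimensional V (the only case used) it is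
   enough that the directional derivatives are C^(k-1). *)
Fixpoint Ck_on (R : realType) (V W : normedModType R) (k : nat)
    (U : set V) (f : V -> W) : Prop :=
  match k with
  | 0%N => forall x, U x -> {for x, continuous f}
  | k'.+1 => (forall x, U x -> differentiable f x) /\
             (forall v, Ck_on k' U (fun x => 'D_v f x))
  end.

Definition smooth_on (R : realType) (V W : normedModType R)
    (U : set V) (f : V -> W) : Prop := forall k, Ck_on k U f.

#[short(type="topologicalGroupType")]
HB.structure Definition TopologicalGroup := {G of Group G & Topological G}.

(* The axioms of a topological group are not part of the structure
   topologicalGroupType, which only combines a group law and a topology; they
   are the fields lie_mul_continuous and lie_inv_continuous below. *)
Record chart (R : realType) (G : topologicalType) (m : nat) := Chart {
  chart_dom : set G;
  chart_map : G -> 'rV[R]_m;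
  chart_inv : 'rV[R]_m -> G }.

Definition chart_im (R : realType) (G : topologicalType) (m : nat)
  (c : chart R G m) : set 'rV[R]_m := chart_map c @` chart_dom c.

Definition is_chart (R : realType) (G : topologicalType) (m : nat)
    (c : chart R G m) : Prop :=
  [/\ open (chart_dom c), open (chart_im c),
      (forall x, chart_dom c x -> chart_inv c (chart_map c x) = x),
      (forall x, chart_dom c x -> {for x, continuous (chart_map c)}) &
      (forall y, chart_im c y -> {for y, continuous (chart_inv c)})].

(* Continuity of the operations makes the sets on which the coordinate
   expressions are required to be smooth open. *)
Record lieGroup (R : realType) (G : topologicalGroupType) (m : nat) := LieGroup {
  lie_atlas : set (chart R G m);
  lie_hausdorff : hausdorff_space G;
  lie_second_countable : @second_countable G;
  lie_chart : forall c, lie_atlas c -> is_chart c;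
  lie_cover : forall x : G, exists2 c, lie_atlas c & chart_dom c x;
  lie_compatible : forall c c', lie_atlas c -> lie_atlas c' ->
    smooth_on (chart_map c @` (chart_dom c `&` chart_dom c'))
      (chart_map c' \o chart_inv c);
  lie_mul_continuous : continuous (fun z : G * G => (z.1 * z.2)%g);
  lie_inv_continuous : continuous (fun x : G => (x^-1)%g);
  lie_mul_smooth : forall c1 c2 c3,
    lie_atlas c1 -> lie_atlas c2 -> lie_atlas c3 ->
    smooth_on [set z : 'rV[R]_m * 'rV[R]_m |
        [/\ chart_im c1 z.1, chart_im c2 z.2 &
            chart_dom c3 (chart_inv c1 z.1 * chart_inv c2 z.2)%g]]
      (fun z => chart_map c3 (chart_inv c1 z.1 * chart_inv c2 z.2)%g);
  lie_inv_smooth : forall c1 c2, lie_atlas c1 -> lie_atlas c2 ->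
    smooth_on [set x | chart_im c1 x /\ chart_dom c2 ((chart_inv c1 x)^-1)%g]
      (fun x => chart_map c2 ((chart_inv c1 x)^-1)%g) }.

(** Group actions on Q and their lifts.  The configuration manifold is given in
    coordinates, as an open subset Q of R^n; T*Q is then Q x R^n. *)

(* Smoothness is joint smoothness on G x Q. *)
Definition lie_action (R : realType) (G : topologicalGroupType) (m n : nat)
    (L : lieGroup R G m) (Q : set 'rV[R]_n) (act : G -> 'rV[R]_n -> 'rV[R]_n)
    : Prop :=
  [/\ (forall q, Q q -> act 1%g q = q),
      (forall g g' q, Q q -> act (g * g')%g q = act g (act g' q)) &
      (forall c, lie_atlas L c ->
        smooth_on (chart_im c `*` Q)
          (fun z : 'rV[R]_m * 'rV[R]_n => act (chart_inv c z.1) z.2))].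

(* The fibre part of the tangent lift TL_g at q. *)
Definition tangent_lift (R : realType) (G : topologicalGroupType) (n : nat)
    (act : G -> 'rV[R]_n -> 'rV[R]_n) (g : G) (q v : 'rV[R]_n) : 'rV[R]_n :=
  'd (act g) q v.

(* The fibre part of the cotangent lift at (q, p), with i-th component
   sum_j p_j dq^j / d(gq)^i: q is the image of gq under the action of g^-1, and
   the (i, j) entry of 'J f x is the i-th partial derivative of f^j. *)
Definition cotangent_lift (R : realType) (G : topologicalGroupType) (n : nat)
    (act : G -> 'rV[R]_n -> 'rV[R]_n) (g : G) (q p : 'rV[R]_n) : 'rV[R]_n :=
  \row_i \sum_j p 0 j * ('J (act (g^-1)%g) (act g q)) i j.

(* The discrete Lagrangian pairs p1 with the coordinate displacement
   q1 - phi(h); the lifted action on (q1, p1) preserves such pairings exactly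
   when gq' - gq = TL_g (q' - q), that is, when the action is affine. *)
Definition affine_on (R : realType) (n : nat) (Q : set 'rV[R]_n)
    (f : 'rV[R]_n -> 'rV[R]_n) : Prop :=
  exists (A : 'M[R]_n) (a : 'rV[R]_n), forall q, Q q -> f q = q *m A + a.

(** Interpolatory functions *)

(* The derivative of f at t relative to [a, b]: one-sided at the endpoints. *)
Definition diff_quotient (R : realType) (n : nat) (f : R -> 'rV[R]_n) (t s : R)
  : 'rV[R]_n := (s - t)^-1 *: (f s - f t).

Definition derivable_in (R : realType) (n : nat) (a b : R)
    (f : R -> 'rV[R]_n) (t : R) : Prop :=
  cvg (diff_quotient f t @ within `[a, b] t^').

Definition derive_in (R : realType) (n : nat) (a b : R)
    (f : R -> 'rV[R]_n) (t : R) : 'rV[R]_n :=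
  lim (diff_quotient f t @ within `[a, b] t^').

Definition C2_in (R : realType) (n : nat) (a b : R) (f : R -> 'rV[R]_n) : Prop :=
  [/\ (forall t, t \in `[a, b] -> derivable_in a b f t),
      (forall t, t \in `[a, b] -> derivable_in a b (derive_in a b f) t) &
      {within `[a, b], continuous (derive_in a b (derive_in a b f))}].

(* Q^k, a k-tuple of points being stored as the rows of a matrix. *)
Definition points_in (R : realType) (n k : nat) (Q : set 'rV[R]_n)
  : set 'M[R]_(k, n) := [set X | forall i, Q (row i X)].

Definition act_points (R : realType) (G : topologicalGroupType) (n k : nat)
    (act : G -> 'rV[R]_n -> 'rV[R]_n) (g : G) (X : 'M[R]_(k, n)) : 'M[R]_(k, n) :=
  \matrix_(i < k) act g (row i X).

(* phi X t is phi(t; {q^nu}) where q^nu is the nu-th row of X. *)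
Definition interpolatory (R : realType) (n r : nat) (Q : set 'rV[R]_n) (h : R)
    (d : 'I_(1 + r) -> R) (phi : 'M[R]_(1 + r, n) -> R -> 'rV[R]_n) : Prop :=
  forall X, points_in Q X ->
    [/\ (forall t, t \in `[0, h] -> Q (phi X t)),
        C2_in 0 h (phi X) &
        (forall nu, phi X (d nu * h) = row nu X)].

Definition equivariant (R : realType) (G : topologicalGroupType) (n r : nat)
    (Q : set 'rV[R]_n) (h : R) (act : G -> 'rV[R]_n -> 'rV[R]_n)
    (phi : 'M[R]_(1 + r, n) -> R -> 'rV[R]_n) : Prop :=
  forall g X t, points_in Q X -> t \in `[0, h] ->
    phi (act_points act g X) t = act g (phi X t).

(** Extremal values *)

Definition stationary_value (R : realType) (V : normedModType R)
    (D : set V) (F : V -> R^o) (v : R^o) : Prop :=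
  exists x, [/\ D x, differentiable F x, (forall y, 'd F x y = 0) & F x = v].

(* ext is meaningful when there is exactly one stationary value (possibly
   attained at several points), which is what ext_well_defined says. *)
Definition ext (R : realType) (V : normedModType R)
    (D : set V) (F : V -> R^o) : R^o := get (stationary_value D F).

Definition ext_well_defined (R : realType) (V : normedModType R)
    (D : set V) (F : V -> R^o) : Prop := exists! v, stationary_value D F v.

(** Generalized Lagrangians *)

Definition gen_lagrangian (R : realType) (n : nat)
    (H : 'rV[R]_n -> 'rV[R]_n -> R) (q v p : 'rV[R]_n) : R :=
  pairing p v - H q p.

Definition gen_lagrangian_invariant (R : realType) (G : topologicalGroupType)
    (n : nat) (Q : set 'rV[R]_n) (act : G -> 'rV[R]_n -> 'rV[R]_n)
    (Rl : 'rV[R]_n -> 'rV[R]_n -> 'rV[R]_n -> R) : Prop :=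
  forall g q v p, Q q ->
    Rl (act g q) (tangent_lift act g q v) (cotangent_lift act g q p) = Rl q v p.

(* The variables of the extremization are x.1 = (q^1, ..., q^r) and
   x.2 = (p^1, ..., p^s); the constraint q^0 = q0 is built in. *)
Definition Hd_domain (R : realType) (n r s : nat) (Q : set 'rV[R]_n)
  : set ('M[R]_(r, n) * 'M[R]_(s, n))%type := [set x | points_in Q x.1].

Definition Hd_objective (R : realType) (n r s : nat) (h : R) (b c : 'I_s -> R)
    (phi : 'M[R]_(1 + r, n) -> R -> 'rV[R]_n)
    (H : 'rV[R]_n -> 'rV[R]_n -> R) (q0 p1 : 'rV[R]_n)
    (x : ('M[R]_(r, n) * 'M[R]_(s, n))%type) : R^o :=
  let curve := phi (col_mx q0 x.1) in
  pairing p1 (curve h) -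
  \sum_(i < s) b i *
     gen_lagrangian H (curve (c i * h)) (derive_in 0 h curve (c i * h))
       (row i x.2).

Definition Hd_plus (R : realType) (n r s : nat) (Q : set 'rV[R]_n) (h : R)
    (b c : 'I_s -> R) (phi : 'M[R]_(1 + r, n) -> R -> 'rV[R]_n)
    (H : 'rV[R]_n -> 'rV[R]_n -> R) (q0 p1 : 'rV[R]_n) : R :=
  ext (@Hd_domain R n r s Q) (Hd_objective h b c phi H q0 p1).

Definition gen_discrete_lagrangian (R : realType) (n r s : nat)
    (Q : set 'rV[R]_n) (h : R) (b c : 'I_s -> R)
    (phi : 'M[R]_(1 + r, n) -> R -> 'rV[R]_n)
    (H : 'rV[R]_n -> 'rV[R]_n -> R) (q0 q1 p1 : 'rV[R]_n) : R :=
  pairing p1 q1 - Hd_plus Q h b c phi H q0 p1.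

Definition gen_discrete_lagrangian_invariant (R : realType)
    (G : topologicalGroupType) (n : nat) (Q : set 'rV[R]_n)
    (act : G -> 'rV[R]_n -> 'rV[R]_n)
    (Rd : 'rV[R]_n -> 'rV[R]_n -> 'rV[R]_n -> R) : Prop :=
  forall g q0 q1 p1, Q q0 -> Q q1 ->
    Rd (act g q0) (act g q1) (cotangent_lift act g q1 p1) = Rd q0 q1 p1.

(* Main.v *)
Require Import Defs.
From HB Require Import structures.
From mathcomp Require Import all_boot all_order all_algebra.
From mathcomp Require Import all_classical all_reals all_analysis.
Import Order.TTheory GRing.Theory Num.Theory.
Import numFieldNormedType.Exports.
Local Open Scope classical_set_scope.
Local Open Scope ring_scope.

(* Write the action of g on Q as q |-> q A + a and that of g^-1 as
   q |-> q B + b.  Differentiating g^-1 g = id on the open set Q gives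
   A B = B A = 1, so the cotangent lift of p is p B^T.  By equivariance of phi
   and invariance of the Lagrangian, the change of variables
   (q^nu, p^i) |-> (g^-1 q^nu, g^-1 p^i) turns the objective at (q0, p1) into the
   objective at (g q0, g p1) plus the constant p1 . b.  It therefore carries
   stationary points to stationary points and shifts the extremal value by that
   constant, which is exactly the defect p1 . (a B) = - p1 . b of the pairing of
   g p1 with g q1. *)

(** * Differentials of locally equal maps and of matrix multiplication *)

(** Both maps have the same first-order expansion at [x], and a differential is unique. This local
    form is used for identities known only on an open set such as [Q]. *)
Lemma near_eq_is_diff {R : numFieldType} {V W : normedModType R}
    {f g df : V -> W} {x : V} :
  (\forall y \near x, f y = g y) -> is_diff x g df -> is_diff x f df.
Proof.
move=> fg gdf; have dg : differentiable g x by exact: ex_diff.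
have dfc := diff_continuous dg.
have fE : f \o shift x = cst (f x) + 'd g x +o_ 0 id.
  apply/eqaddoP => _/posnumP[e].
  have /eqaddoP/(_ e%:num [gt0 of e%:num]) := diff_locally dg.
  have := fg; rewrite (near_shift 0 x) subr0 => fg0.
  apply: filterS2 fg0 => y fgy.
  by rewrite [X in _ -> `|X| <= _]/(_ - (_ + _)) /= fgy (nbhs_singleton fg).
have dfE : 'd f x = 'd g x :> (V -> W) by exact: diff_unique.
apply: DiffDef; last by rewrite dfE diff_val.
by apply/diff_locallyP; rewrite dfE.
Qed.

Lemma mulmxr_continuous {R : realType} {k l n : nat} (B : 'M[R]_(l, n)) :
  continuous (fun X : 'M[R]_(k, l) => X *m B).
Proof.
have coordXB i j : continuous (fun X : 'M[R]_(k, l) => (X *m B) i j).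
  move=> X; apply/differentiable_continuous.
  have -> : (fun X : 'M[R]_(k, l) => (X *m B) i j) =
      \sum_(u < l) (fun X : 'M[R]_(k, l) => X i u * B u j).
    by apply/funext => Y; rewrite mxE fct_sumE.
  apply: differentiable_sum => u.
  by apply: differentiableM;
    [exact: differentiable_coord|exact: differentiable_cst].
move=> X A [P XP PA].
have PXB i j : \forall Y \near X, P i j (((Y : 'M[R]_(k, l)) *m B) i j).
  by apply: coordXB; exact: XP.
have PXBi i :
    \forall Y \near X, forall j, P i j (((Y : 'M[R]_(k, l)) *m B) i j).
  exact: filter_forall (PXB i).
have := filter_forall (nbhs_filter X) PXBi.
by apply: filterS => Y PY; apply: PA => i j; exact: PY.
Qed.

Lemma differentiable_mulmxr {R : realType} {k l n : nat} (B : 'M[R]_(l, n))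
    (X : 'M[R]_(k, l)) :
  differentiable (mulmxr B) X.
Proof. by apply: linear_differentiable; exact: mulmxr_continuous. Qed.

Lemma is_diff_mulmxr {R : realType} {k l n : nat} (B : 'M[R]_(l, n))
    (C : 'M[R]_(k, n)) (X : 'M[R]_(k, l)) :
  is_diff X (fun Y => Y *m B + C) (mulmxr B).
Proof.
have -> : (fun Y => Y *m B + C) = mulmxr B + cst C by [].
apply: is_diff_eq; last exact: addr0.
apply: is_diffD; apply: DiffDef; first exact: differentiable_mulmxr.
by apply: diff_lin; exact: mulmxr_continuous.
Qed.

(** Neighbourhoods of a matrix are given entrywise, so the condition on each row is open, and there
    are finitely many rows. *)
Lemma open_points_in {R : realType} {n k : nat} {Q : set 'rV[R]_n} :
  open Q -> open (points_in Q : set 'M[R]_(k, n)).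
Proof.
rewrite !openE => Qo X QX.
have QXi i : \forall Y \near X, Q (row i (Y : 'M[R]_(k, n))).
  have [P XP PA] := Qo _ (QX i).
  have PX j : \forall Y \near X, P 0 j ((Y : 'M[R]_(k, n)) i j).
    by apply: coord_continuous; have := XP 0 j; rewrite mxE.
  have : \forall Y \near X, forall j, P 0 j ((Y : 'M[R]_(k, n)) i j).
    exact: filter_forall PX.
  by apply: filterS => Y PY; apply: PA => i0 j; rewrite ord1 mxE.
exact: filter_forall QXi.
Qed.

(** * Derivatives relative to a closed interval *)

(** No point of a nondegenerate interval is isolated in it: approach [t] from the right if [t < b],
    from the left otherwise. Properness makes the limit defining [derive_in] unique. *)
Lemma within_itv_proper {R : realType} {a b t : R} :
  a < b -> t \in `[a, b] -> ProperFilter (within `[a, b] t^').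
Proof.
move=> ab; rewrite in_itv/= => /andP[at_ tb].
apply: Build_ProperFilter_ex => P P_.
have {}P_ : \forall s \near t, s != t -> s \in `[a, b] -> P s by exact: P_.
have [tltb|bt] := ltP t b.
  near t^'+ => s; exists s.
  have : s != t -> s \in `[a, b] -> P s by near: s; exact: cvg_within.
  have ts : t < s by near: s; exact: nbhs_right_gt.
  apply; first by rewrite gt_eqF.
  rewrite in_itv/= (le_trans at_ (ltW ts)); near: s; exact: nbhs_right_le.
near t^'- => s; exists s.
have : s != t -> s \in `[a, b] -> P s by near: s; exact: cvg_within.
have st : s < t by near: s; exact: nbhs_left_lt.
apply; first by rewrite lt_eqF.
rewrite in_itv/= (le_trans (ltW st) tb) andbT; near: s.
exact/nbhs_left_ge/(lt_le_trans ab).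
Unshelve. all: by end_near. Qed.

(** The translation [c] cancels in the difference quotient, and right multiplication by [A] is
    continuous, so it passes to the limit. *)
Lemma derive_in_affine {R : realType} {n : nat} {a b t : R}
    {f g : R -> 'rV[R]_n} {A : 'M[R]_n} {c : 'rV[R]_n} :
  a < b -> t \in `[a, b] ->
  (forall s, s \in `[a, b] -> g s = f s *m A + c) ->
  derivable_in a b f t -> derive_in a b g t = derive_in a b f t *m A.
Proof.
move=> ab tab gE df; have PF := within_itv_proper ab tab.
apply: cvg_lim => //.
have : (fun s => diff_quotient f t s *m A) @ within `[a, b] t^' -->
    derive_in a b f t *m A.
  exact: cvg_comp df (mulmxr_continuous A (derive_in a b f t)).
apply: cvg_trans; apply: near_eq_cvg.
have sab : \forall s \near within `[a, b] t^', s \in `[a, b].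
  exact: withinT.
apply: filterS sab => s sab.
rewrite /diff_quotient/= !gE//.
by rewrite opprD addrACA subrr addr0 -mulmxBl scalemxAl.
Qed.

(** * Stationary values under a change of variables *)

(** By the chain rule the differential of [G] at [y] is that of [F] at [tau y] composed with that of
    [tau], hence zero wherever the former vanishes. The inclusion of [D] in the image of [E]
    provides a preimage of the stationary point, and openness of [E] makes [G] agree with
    [F \o tau + k] near it. *)
Lemma stationary_value_comp {R : realType} {V W : normedModType R}
    {D : set V} {E : set W} {F : V -> R^o} {G : W -> R^o} (tau : W -> V)
    {k v : R^o} :
  open E -> (forall y, E y -> differentiable tau y) ->
  D `<=` tau @` E -> (forall y, E y -> G y = F (tau y) + k) ->
  stationary_value D F v -> stationary_value E G (v + k).
Proof.
move=> Eo dtau DE GE [x [Dx dF dF0 <-]].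
have [y Ey yx] := DE _ Dx; rewrite -yx in dF dF0 *.
have dy := dtau _ Ey.
have dG : is_diff y G (('d F (tau y) \o 'd tau y) \+ cst 0).
  apply: (@near_eq_is_diff _ _ _ _ (F \o tau + cst k)).
    by move/open_nbhs_nbhs : (conj Eo Ey); apply: filterS; exact: GE.
  by apply: is_diffD; apply: is_diff_comp; exact: differentiableP.
exists y; split; rewrite ?GE//.
by move=> z; rewrite diff_val /= dF0 addr0.
Qed.

Lemma ext_eq {R : realType} {V : normedModType R} {D : set V} {F : V -> R^o}
    {v : R^o} :
  ext_well_defined D F -> stationary_value D F v -> ext D F = v.
Proof.
move=> [w [Fw w_uniq]] Fv; rewrite /ext.
by rewrite -(w_uniq _ Fv); apply/esym/w_uniq; apply: getPex; exists v.
Qed.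

Lemma pairingDr (R : realType) (n : nat) (p u v : 'rV[R]_n) :
  pairing p (u + v) = pairing p u + pairing p v.
Proof. by rewrite -big_split; apply: eq_bigr => i _; rewrite mxE mulrDr. Qed.

Lemma pairing_mulmx (R : realType) (n : nat) (p v : 'rV[R]_n) (A : 'M[R]_n) :
  pairing (p *m A^T) v = pairing p (v *m A).
Proof.
have pE (q w : 'rV[R]_n) : pairing q w = (q *m w^T) 0 0.
  by rewrite mxE; apply: eq_bigr => i _; rewrite mxE.
by rewrite !pE trmx_mul mulmxA.
Qed.

(** * Affine actions and their lifts *)

Section affine_action.
Context {R : realType} {G : topologicalGroupType} {n : nat}.
Context {Q : set 'rV[R]_n} (Q_open : open Q) {act : G -> 'rV[R]_n -> 'rV[R]_n}.
Implicit Types (g : G) (q p v : 'rV[R]_n) (A B : 'M[R]_n).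

Lemma is_diff_affine_on {f : 'rV[R]_n -> 'rV[R]_n} {A a q} :
  (forall q, Q q -> f q = q *m A + a) -> Q q -> is_diff q f (mulmxr A).
Proof.
move=> fE Qq; apply: near_eq_is_diff (is_diff_mulmxr A a q).
by move/open_nbhs_nbhs : (conj Q_open Qq); apply: filterS => y; exact: fE.
Qed.

Lemma tangent_liftE {g A a q} v :
  (forall q, Q q -> act g q = q *m A + a) -> Q q ->
  tangent_lift act g q v = v *m A.
Proof.
move=> gE Qq; have dg := is_diff_affine_on gE Qq.
by rewrite /tangent_lift diff_val.
Qed.

Lemma cotangent_liftE {g B b q} p :
  (forall q, Q q -> act g^-1%g q = q *m B + b) -> Q (act g q) ->
  cotangent_lift act g q p = p *m B^T.
Proof.
move=> gE Qgq; have dg := is_diff_affine_on gE Qgq.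
have JE : 'J (act g^-1%g) (act g q) = B.
  by apply/row_matrixP => i; rewrite !rowE mul_rV_lin1 diff_val.
rewrite /cotangent_lift JE; apply/rowP => i; rewrite !mxE.
by apply: eq_bigr => j _; rewrite mxE.
Qed.

(** The linear part of an affine map is its differential, so it is determined on the open set [Q];
    the translation parts are then compared at [q]. *)
Lemma affine_cancel_mulmx {f f' : 'rV[R]_n -> 'rV[R]_n} {A B a b q} :
  Q q -> (forall q, Q q -> f q = q *m A + a) ->
  (forall q, Q q -> f' q = q *m B + b) ->
  (forall q, Q q -> Q (f q)) -> (forall q, Q q -> f' (f q) = q) ->
  A *m B = 1%:M /\ a *m B + b = 0.
Proof.
move=> Qq fE f'E Qf f'f.
have idE x : Q x -> id x = x *m (A *m B) + (a *m B + b).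
  move=> Qx; rewrite /= -{1}(f'f _ Qx) f'E; last exact: Qf.
  by rewrite fE// mulmxDl mulmxA addrA.
have did := is_diff_affine_on idE Qq.
have AB : A *m B = 1%:M.
  have dE := @diff_val _ _ _ _ _ _ _ did.
  have /= dE0 := @diff_val _ _ _ _ _ _ _ (is_diff_id q).
  apply/row_matrixP => i; rewrite !rowE mulmx1.
  by rewrite -[LHS]/(mulmxr (A *m B) _) -dE dE0.
split=> //; have := idE _ Qq; rewrite AB mulmx1 /= => /eqP.
by rewrite addrC -subr_eq subrr eq_sym => /eqP.
Qed.

Lemma act_pointsE {k} {g A a} {X : 'M[R]_(k, n)} :
  (forall q, Q q -> act g q = q *m A + a) -> points_in Q X ->
  act_points act g X = X *m A + \matrix_(i < k) a.
Proof.
move=> gE QX; apply/row_matrixP => i.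
by rewrite linearD/= row_mul !rowK gE//; exact: QX.
Qed.

Lemma points_in_act {k} {g} {X : 'M[R]_(k, n)} :
  (forall q, Q q -> Q (act g q)) -> points_in Q X ->
  points_in Q (act_points act g X).
Proof. by move=> Qg QX i; rewrite rowK; apply: Qg; exact: QX. Qed.

Lemma act_points_col_mx {k} g q (X : 'M[R]_(k, n)) :
  act_points act g (col_mx q X) = col_mx (act g q) (act_points act g X).
Proof.
apply/row_matrixP => i; rewrite rowK; case: (split_ordP i) => j ->.
  by rewrite !rowKu [j]ord1 !row_id.
by rewrite !rowKd rowK.
Qed.

Lemma points_in_col_mx {k} {q} {X : 'M[R]_(k, n)} :
  Q q -> points_in Q X -> points_in Q (col_mx q X).
Proof.
move=> Qq QX i; case: (split_ordP i) => j ->; last by rewrite rowKd.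
by rewrite rowKu [j]ord1 row_id.
Qed.

(** The transformed data yield the curve [phi A + a], with velocity multiplied by [A]. Invariance of
    the Lagrangian preserves each quadrature term, so only the endpoint pairing changes, by the
    translation paired with the transformed momentum. *)
Lemma Hd_objective_act {r s : nat} {h : R} {d : 'I_(1 + r) -> R}
    {b c : 'I_s -> R} {phi : 'M[R]_(1 + r, n) -> R -> 'rV[R]_n}
    {H : 'rV[R]_n -> 'rV[R]_n -> R} {g A B a a' q} p
    {x : ('M[R]_(r, n) * 'M[R]_(s, n))%type} :
  0 < h -> (forall i, c i \in `[0, 1]) -> interpolatory Q h d phi ->
  equivariant Q h act phi ->
  gen_lagrangian_invariant Q act (gen_lagrangian H) ->
  (forall q, Q q -> act g q = q *m A + a) ->
  (forall q, Q q -> act g^-1%g q = q *m B + a') -> A *m B = 1%:M ->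
  (forall q, Q q -> Q (act g q)) -> Q q -> points_in Q x.1 ->
  Hd_objective h b c phi H (act g q) (p *m B^T)
    (x.1 *m A + \matrix_(i < r) a, x.2 *m B^T) =
  Hd_objective h b c phi H q p x + pairing (p *m B^T) a.
Proof.
move=> h0 c01 phiQ phig Rg gE g'E AB Qg Qq Qx.
have QX := points_in_col_mx Qq Qx.
have [phiXQ [dphi _ _] _] := phiQ _ QX.
have phiE t : t \in `[0, h] ->
    phi (col_mx (act g q) (x.1 *m A + \matrix_(i < r) a)) t =
    phi (col_mx q x.1) t *m A + a.
  move=> th; rewrite -(act_pointsE gE Qx) -act_points_col_mx phig//.
  by rewrite gE//; exact: phiXQ.
have hh : h \in `[0, h] by rewrite in_itv/= lexx ltW.
rewrite /Hd_objective /= phiE// pairingDr pairing_mulmx -mulmxA AB mulmx1.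
rewrite -[in RHS]addrA [in RHS](addrC (- _)) [in RHS]addrA; congr (_ - _).
apply: eq_bigr => i _; congr (_ * _).
have cih : c i * h \in `[0, h].
  have := c01 i; rewrite !in_itv/= => /andP[c0 c1].
  by rewrite mulr_ge0 ?(ltW h0)//= ler_piMl// ltW.
have Qphi := phiXQ _ cih.
(* The invariance concerns the lift of the i-th momentum at the curve point at time [c i * h]; for
   an affine action this lift is multiplication by [B^T] at every point of [Q]. *)
rewrite (derive_in_affine h0 cih phiE (dphi _ cih)) phiE// -gE//.
rewrite -(tangent_liftE _ gE Qphi) row_mul -(cotangent_liftE _ g'E (Qg _ Qphi)).
exact: Rg.
Qed.

End affine_action.

Theorem lemma3 (R : realType) (G : topologicalGroupType) (m n r s : nat)
    (L : lieGroup R G m)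
    (Q : set 'rV[R]_n) (Q_open : open Q)
    (act : G -> 'rV[R]_n -> 'rV[R]_n)
    (act_lie : lie_action L Q act)
    (gQ : forall g, act g @` Q = Q)
    (act_affine : forall g, affine_on Q (act g))
    (H : 'rV[R]_n -> 'rV[R]_n -> R)
    (h : R) (h_gt0 : 0 < h)
    (d : 'I_(1 + r) -> R) (d0 : d ord0 = 0)
    (d_incr : forall i j : 'I_(1 + r), (i < j)%N -> d i < d j)
    (dr : d ord_max * h <= h)
    (b c : 'I_s -> R) (c01 : forall i, c i \in `[0, 1])
    (phi : 'M[R]_(1 + r, n) -> R -> 'rV[R]_n)
    (phi_interp : interpolatory Q h d phi)
    (phi_equiv : equivariant Q h act phi)
    (ext_wd : forall q0 p1, Q q0 ->
       ext_well_defined (@Hd_domain R n r s Q) (Hd_objective h b c phi H q0 p1))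
    (R_inv : gen_lagrangian_invariant Q act (gen_lagrangian H)) :
  gen_discrete_lagrangian_invariant Q act
    (gen_discrete_lagrangian Q h b c phi H).
Proof.
move=> g q0 q1 p1 Qq0 Qq1; have [act1 actM _] := act_lie.
have Qact f q : Q q -> Q (act f q) by move=> Qq; rewrite -(gQ f); exists q.
have actK f q : Q q -> act f^-1%g (act f q) = q.
  by move=> Qq; rewrite -actM// mulVg act1.
have [A [a gE]] := act_affine g; have [B [a' g'E]] := act_affine g^-1%g.
have [AB aB] := affine_cancel_mulmx Q_open Qq0 gE g'E (Qact g) (actK g).
have BA := mulmx1C AB.
(* The lift is based at [q1], but its matrix [B^T] does not depend on the base point, so the same
   [p1'] serves in the objective based at [act g q0]. *)
rewrite (cotangent_liftE Q_open _ g'E (Qact _ _ Qq1)).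
set p1' := p1 *m B^T.
have p1'A : p1' *m A^T = p1 by rewrite -mulmxA -trmx_mul AB trmx1 mulmx1.
(* [tau] applies the inverse of g to the points and its cotangent lift, multiplication by [A^T], to
   the momenta. *)
pose tau (y : ('M[R]_(r, n) * 'M[R]_(s, n))%type) :=
  (y.1 *m B + \matrix_(i < r) a', y.2 *m A^T).
have [v [Fv _]] := ext_wd q0 p1 Qq0.
have Gv : stationary_value (@Hd_domain R n r s Q)
    (Hd_objective h b c phi H (act g q0) p1') (v - pairing p1 a').
  apply: (stationary_value_comp tau _ _ _ _ Fv).
  - have -> : @Hd_domain R n r s Q = fst @^-1` (points_in Q) by [].
    apply: open_comp; last exact: open_points_in.
    by move=> ? _; exact: cvg_fst.
  - move=> y _; apply: differentiable_pair.
      apply: (@differentiable_comp _ _ _ _ fst (fun X => X *m B + _)).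
        by apply: linear_differentiable => z; exact: cvg_fst.
      have dB := is_diff_mulmxr B (\matrix_(i < r) a') y.1; exact: ex_diff.
    apply: (@differentiable_comp _ _ _ _ snd (mulmxr A^T)).
      by apply: linear_differentiable => z; exact: cvg_snd.
    exact: differentiable_mulmxr.
  (* A preimage under [tau] is obtained by acting with [g] on points and momenta. *)
  - move=> [X P] /= QX; exists (act_points act g X, P *m B^T).
      exact: points_in_act (Qact g) QX.
    rewrite /tau /= -mulmxA -trmx_mul AB trmx1 mulmx1; congr (_, _).
    rewrite -(act_pointsE g'E (points_in_act (Qact g) QX)).
    by apply/row_matrixP => i; rewrite !rowK actK//; exact: QX.
  - move=> y Qy; apply/eqP; rewrite -subr_eq opprK; apply/eqP/esym.
    (* The objective identity is applied to the inverse of [g] at the transformed data, with [A] and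
       [B] exchanged; it leads back to [q0] and [p1], with shift [pairing p1 a']. *)
    have Qgq0 := Qact g _ Qq0.
    have := Hd_objective_act Q_open p1' h_gt0 c01 phi_interp phi_equiv R_inv
      g'E _ BA (Qact _) Qgq0 Qy.
    rewrite invgK p1'A actK//; apply; exact: gE.
rewrite /gen_discrete_lagrangian /Hd_plus.
rewrite (ext_eq (ext_wd _ _ Qq0) Fv).
rewrite (ext_eq (ext_wd _ _ (Qact _ _ Qq0)) Gv).
rewrite gE// pairing_mulmx mulmxDl -mulmxA AB mulmx1 pairingDr.
(* Since [a *m B + a' = 0], the pairing with [act g q1] and the extremal value both change by
   [- pairing p1 a']. *)
have : pairing p1 (a *m B) + pairing p1 a' = 0.
  rewrite -pairingDr aB.
  by rewrite /pairing big1// => i _; rewrite mxE mulr0.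
move=> /eqP; rewrite addr_eq0 => /eqP ->.
by rewrite opprD opprK addrACA addNr addr0.
Qed.
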